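(* Let $\mu$ be a balanced measure on $\mathbb{R}$, let $N\ge1$ be an integer and $1\le p<\infty$. There are constants $C_1,C_2>0$ independent of $w$ (depending only on $\mu$, $p$ and $N$) such that for every weight $w$ $$[w]_{A_p^b(\mu)}\le C_1[w]_{A_p^N(\mu)},\qquad [w]_{A_p^N(\mu)}\le C_2\left([w]_{A_p^b(\mu)}\right)^{2^{N-1}}.$$ In particular, $[w]_{A_p^N(\mu)}<\infty$ if and only if $[w]_{A_p^b(\mu)}<\infty$.
   Context: $\mathscr{D}$ is the standard dyadic system of half-open intervals $2^{-k}[j,j+1)$, $j,k\in\mathbb{Z}$. For $I\in\mathscr{D}$, $I_-$ and $I_+$ are its left and right dyadic children, $\widehat{I}$ its dyadic parent, $I^b$ its dyadic sibling (the other child of $\widehat{I}$), $I^b_\pm$ the right/left children of $I^b$, and $I^{(j)}$ its $j$-th dyadic ancestor ($I^{(0)}=I$). The dyadic distance is $\operatorname{dist}_{\mathscr{D}}(I,J)=\min\{s+t:\ s,t\ge0,\ I^{(s)}=J^{(t)}\}$, and $=\infty$ if $I,J$ have no common dyadic ancestor. $\mu$ is a Borel measure on $\mathbb{R}$ with $0<\mu(I)<\infty$ for all $I\in\mathscr{D}$; $\langle f\rangle_I=\mu(I)^{-1}\int_I f\,d\mu$ and $m(I)=\mu(I_-)\mu(I_+)/\mu(I)$. The measure $\mu$ is balanced if it has no atoms and there is $c\ge1$ with $c^{-1}m(\widehat{I})\le m(I)\le c\,m(\widehat{I})$ for all $I\in\mathscr{D}$. A weight is a $\mu$-a.e. positive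 function $w\in L^1_{\mathrm{loc}}(\mu)$; $p'$ is the conjugate exponent of $p$. For $1\le p<\infty$: $c_p^b(I,J)=1$ if $I=J$ and $c_p^b(I,J)=\frac{m(I)^{p/2}m(J)^{p/2}}{\mu(J)\mu(I)^{p-1}}$ otherwise. For $1<p<\infty$, $$[w]_{A_p^b(\mu)}=\sup c_p^b(I,J)\langle w\rangle_I\langle w^{1-p'}\rangle_J^{p-1}\ \text{ over } I,J\in\mathscr{D} \text{ with } J\in\{I,I^b_-,I^b_+\}\text{ or }I\in\{J^b_-,J^b_+\},$$ $$[w]_{A_p^N(\mu)}=\sup c_p^b(I,J)\langle w\rangle_I\langle w^{1-p'}\rangle_J^{p-1}\ \text{ over } I,J\in\mathscr{D}\text{ with }\operatorname{dist}_{\mathscr{D}}(I,J)\le N+2.$$ For $p=1$, $[w]_{A_1^b(\mu)}$ and $[w]_{A_1^N(\mu)}$ are the suprema of $c_1^b(I,J)\langle w\rangle_I\|w^{-1}\|_{L^\infty(J)}$ over the same respective families of pairs $(I,J)$. These quantities may be $+\infty$. *)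

(* Defs.v *)
From HB Require Import structures.
From mathcomp Require Import all_boot all_order all_algebra.
From mathcomp Require Import all_classical all_reals all_analysis.
From mathcomp Require Import zify ring lra.

Set Implicit Arguments.
Unset Strict Implicit.
Unset Printing Implicit Defensive.

Import Order.TTheory GRing.Theory Num.Theory.
Import numFieldNormedType.Exports.

Local Open Scope classical_set_scope.
Local Open Scope ring_scope.

(* The index (k, j) stands for the interval 2^-k [j, j + 1); distinct indices
   give distinct intervals (dyad_inj below), so dyadic intervals are compared
   through their indices. *)
Definition dyadic := (int * int)%type.

Definition dyad (R : realType) (I : dyadic) : set R :=
  `[2 ^ (- I.1) * I.2%:~R, 2 ^ (- I.1) * (I.2 + 1)%:~R[.

Arguments dyad : clear implicits.

Definition childl (I : dyadic) : dyadic := (I.1 + 1, 2 * I.2).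
Definition childr (I : dyadic) : dyadic := (I.1 + 1, 2 * I.2 + 1).

(* %/ is the floor division of integers (the divisor is positive). *)
Definition parent (I : dyadic) : dyadic := (I.1 - 1, (I.2 %/ 2)%Z).

Definition sibling (I : dyadic) : dyadic :=
  if I == childl (parent I) then childr (parent I) else childl (parent I).

Definition ancestor (n : nat) (I : dyadic) : dyadic := iter n parent I.

(* A minimum of natural numbers, equal to +oo when there is no common
   ancestor. *)
Definition dyadic_dist (R : realType) (I J : dyadic) : \bar R :=
  ereal_inf [set d | exists s t : nat,
    ancestor s I = ancestor t J /\ d = (s + t)%:R%:E].

Lemma parent_childl I : parent (childl I) = I.
Proof.
by case: I => k j; rewrite /parent/= addrK mulrC mulzK.
Qed.

Lemma parent_childr I : parent (childr I) = I.
Proof.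
by case: I => k j; rewrite /parent/= addrK mulrC divzMDl// addr0.
Qed.

Lemma childP I : I = childl (parent I) \/ I = childr (parent I).
Proof.
case: I => k j; rewrite /childl /childr /parent/= subrK.
have e := divz_eq j 2; have l0 := modz_ge0 j (isT : 2 != 0 :> int).
have l2 := ltz_pmod j (isT : 0 < 2 :> int).
have [m0|m1] : (j %% 2)%Z = 0 \/ (j %% 2)%Z = 1 by lia.
  by left; congr pair; lia.
by right; congr pair; lia.
Qed.

Section dyad_facts.
Context {R : realType}.

Lemma dyad_children (I : dyadic) :
  dyad R I = dyad R (childl I) `|` dyad R (childr I) /\
  dyad R (childl I) `&` dyad R (childr I) = set0.
Proof.
case: I => k j; rewrite /dyad/=.
have -> : 2 ^ (- (k + 1)) = 2 ^ (- k) / 2 :> R.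
  by rewrite opprD expfzDr ?pnatr_eq0// exprN1.
have : 0 < 2 ^ (- k) :> R by rewrite exprz_gt0.
move: (2 ^ _) => a a0.
rewrite !(intrD, intrM)/=.
split; apply/seteqP; split => x /=; rewrite !in_itv/=.
- move=> /andP[h1 h2].
  have [h|h] := ltP x (a / 2 * (2 * j%:~R + 1)).
    by left; rewrite andbT; lra.
  by right; lra.
- by case => /andP[h1 h2]; apply/andP; split; nra.
- by case => /andP[h1 h2] /andP[h3 h4]; lra.
- by [].
Qed.

Lemma dyad_inj : injective (dyad R).
Proof.
have p0 (z : int) : 0 < 2 ^ z :> R by rewrite exprz_gt0.
have ne (a b c d : R) : a < b ->
    `[a, b[%classic = `[c, d[%classic -> a = c /\ b = d.
  move=> ab E.
  have cd : c < d.
    have : `[a, b[%classic a by rewrite /= in_itv/= lexx ab.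
    by rewrite E /= in_itv/= => /andP[]; exact: le_lt_trans.
  have hs (x : R) : (a <= x < b) = (c <= x < d).
    have := congr1 (fun S : set R => S x) E; rewrite /= !in_itv/= => h.
    by apply/idP/idP; rewrite h.
  split; apply/eqP; rewrite eq_le; apply/andP; split.
  - by have := hs c; rewrite lexx cd => /andP[].
  - by have := hs a; rewrite lexx ab => /esym/andP[].
  - rewrite leNgt; apply/negP => db.
    have := hs (Num.max a d); rewrite [in RHS]gt_max ltxx !andbF.
    by rewrite le_max lexx/= gt_max ab db.
  - rewrite leNgt; apply/negP => bd.
    have := hs (Num.max c b); rewrite [in LHS]gt_max ltxx !andbF.
    by rewrite le_max lexx/= gt_max cd bd.
move=> [k j] [l i]; rewrite /dyad/= => /ne[].
  by rewrite ltr_pM2l// ltr_int ltzD1.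
rewrite !intrD !mulrDr !mulr1 => E1; rewrite E1 => /addrI E2.
have kl : k = l.
  by apply: oppr_inj; apply: (@ieexprIz R 2); rewrite ?ltr0n ?pnatr_eq1.
subst l; congr pair; apply/eqP.
by move: E1 => /(mulfI (lt0r_neq0 (p0 _)))/eqP; rewrite eqr_int.
Qed.

End dyad_facts.

Section balanced_weights.
Context {R : realType}.
Variable mu : {measure set (measurableTypeR R) -> \bar R}.
Implicit Types (I J : dyadic) (w f : R -> R) (p : R).

Definition dyadic_pos_fin : Prop :=
  forall I, (0 < mu (dyad R I) < +oo)%E.

Definition mass I : R := fine (mu (dyad R I)).

Definition mm I : R := mass (childl I) * mass (childr I) / mass I.

Definition balanced : Prop :=
  (forall x : R, mu [set x] = 0%E) /\
  exists c : R, 1 <= c /\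
    forall I, c^-1 * mm (parent I) <= mm I <= c * mm (parent I).

Definition weight w : Prop :=
  [/\ measurable_fun [set: measurableTypeR R] (w : measurableTypeR R -> R),
      {ae mu, forall x, 0 < w x} &
      forall K : set R, compact K -> (\int[mu]_(x in K) `|w x|%:E < +oo)%E].

Definition average f I : \bar R :=
  ((mass I)^-1%:E * \int[mu]_(x in dyad R I) (f x)%:E)%E.

Definition conjugate p : R := fine (hoelder_conjugate p%:E).

Definition cb p I J : R :=
  if I == J then 1
  else mm I `^ (p / 2) * mm J `^ (p / 2) / (mass J * mass I `^ (p - 1)).

(* the norm of L^oo(J), taken as that of the extension by zero outside J *)
Definition Linfty f J : \bar R :=
  ('N[mu]_(+oo)[(EFin \o f) \_ (dyad R J)])%E.

Definition Ap_term p w I J : \bar R :=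
  ((cb p I J)%:E * average w I *
    if p == 1%R then Linfty (fun x => (w x)^-1%R) J
    else average (fun x => (w x `^ (1 - conjugate p))%R) J `^ (p - 1)%R)%E.

Definition pair_b I J : Prop :=
  [\/ J = I, J = childl (sibling I) | J = childr (sibling I)] \/
  (I = childl (sibling J) \/ I = childr (sibling J)).

Definition pair_N (N : nat) I J : Prop :=
  (dyadic_dist R I J <= (N + 2)%:R%:E)%E.

Definition Ap_char (fam : dyadic -> dyadic -> Prop) p w : \bar R :=
  ereal_sup [set x | exists I J, fam I J /\ x = Ap_term p w I J].

Definition Ap_b p w : \bar R := Ap_char pair_b p w.

Definition Ap_N (N : nat) p w : \bar R := Ap_char (pair_N N) p w.

End balanced_weights.

(* Main.v *)
(* Put W(I) = int_I w, S(J) = (int_J w^(1-p'))^(p-1) (for p = 1, the essential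
   supremum of 1/w on J), and
     D(I, J) = (m(I) m(J))^(p/2) W(I) S(J) / (mu(I) mu(J))^p,
   which is c_p^b(I, J) <w>_I <w^(1-p')>_J^(p-1) when I <> J.  Hoelder's
   inequality mu(L)^p <= W(L) S(L) gives
     D(I, J) <= (mu(L) / m(L))^p D(I, L) D(L, J),
   and mu(L) <= 2 c m(L) for at least one of any two siblings L, because mu is
   balanced.  If I and J are nested at bounded distance, D(I, J) is at most a
   constant times the diagonal term of the larger one.  The remaining pairs are
   joined by chains of such small intervals; a chain needs at most N factors,
   and N <= 2^(N-1). *)
Require Import Defs.
From HB Require Import structures.
From mathcomp Require Import all_boot all_order all_algebra.
From mathcomp Require Import all_classical all_reals all_analysis.
From mathcomp Require Import measurable_realfun ess_sup_inf.
From mathcomp Require Import zify ring lra.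

Import Order.TTheory GRing.Theory Num.Theory.
Import numFieldNormedType.Exports.

Local Open Scope classical_set_scope.
Local Open Scope ring_scope.

(** * Siblings in the dyadic tree *)

Lemma childl_neq_childr I : childl I <> childr I.
Proof. by case=> /eqP; rewrite -subr_eq0 opprD addrA subrr sub0r. Qed.

Lemma parent_sibling I : parent (sibling I) = parent I.
Proof.
by rewrite /sibling; case: ifP => _; rewrite ?parent_childl ?parent_childr.
Qed.

Lemma siblings_parent I J : parent I = parent J -> I = J \/ J = sibling I.
Proof.
move=> IJ; rewrite /sibling.
case: (childP I) => eI; case: (childP J) => eJ; rewrite -IJ in eJ.
- by left; rewrite eI eJ.
- by right; rewrite -eI eqxx.
- right; case: eqP => // e; case: (childl_neq_childr (parent I)).
  by rewrite -e -eI.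
- by left; rewrite eI eJ.
Qed.

Lemma sibling_neq I : I <> sibling I.
Proof.
rewrite /sibling; case: eqP => [{1}-> /childl_neq_childr//|h e]; exact: h.
Qed.

Lemma siblingK : involutive sibling.
Proof.
move=> I; have /siblings_parent[/esym/sibling_neq//|//] :
  parent (sibling I) = parent I by exact: parent_sibling.
Qed.

(* ancestor d J contains J, and an uncle or nephew at distance 3 is the pattern
   of pair_b; chain_through is what Hoelder's inequality provides. *)
Record chain_kernel {R : realFieldType} (n : nat) (small : dyadic -> Prop)
    (G B : R) (D : dyadic -> dyadic -> R) : Prop := ChainKernel {
  chain_ge0 : forall I J, 0 <= D I J;
  chain_up : forall d J, (d <= n)%N -> D (ancestor d J) J <= G * B;
  chain_down : forall d J, (d <= n)%N -> D J (ancestor d J) <= G * B;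
  chain_sibling : forall I, D I (sibling I) <= G * B;
  chain_nephew : forall I J, parent J = sibling I -> D I J <= B;
  chain_uncle : forall I J, parent J = sibling I -> D J I <= B;
  chain_through : forall I L J, small L -> D I J <= G * (D I L * D L J) }.

(** * Chains through small intervals for an abstract kernel *)

Section chains.
Context {R : realFieldType} (n : nat) (small : dyadic -> Prop) (G B : R).
Hypotheses (G1 : 1 <= G) (B1 : 1 <= B).
Hypothesis small_sibling : forall I, small I \/ small (sibling I).

(** Transposition swaps [chain_up] with [chain_down] and [chain_nephew] with [chain_uncle]; a
    one-sided bound thus serves from either end of a pair. *)
Lemma chain_kernel_tr {D} :
  chain_kernel n small G B D ->
  chain_kernel n small G B (fun I J => D J I).
Proof.
case=> D0 Du Dd Ds Dn Dn' Dt; split => //.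
- by move=> I; have := Ds (sibling I); rewrite siblingK.
- by move=> I L J /Dt h; rewrite [D L I * _]mulrC; exact: h.
Qed.

Lemma chain_power_le {a b a' b'} : (a <= a')%N -> (b <= b')%N ->
  G ^+ a * B ^+ b <= G ^+ a' * B ^+ b'.
Proof.
move=> aa bb; rewrite ler_pM ?exprn_ge0 ?ler_weXn2l//.
- exact: le_trans G1.
- exact: le_trans B1.
Qed.

(** Passing through [L] costs one extra factor [G], hence the strict inequality between the
    exponents of [G]; those of [B] merely add up. *)
Lemma chain_trans {D L a b a' b'} {a'' b'' I J} :
  chain_kernel n small G B D -> small L ->
  D I L <= G ^+ a * B ^+ b -> D L J <= G ^+ a' * B ^+ b' ->
  (a + a' < a'')%N -> (b + b' <= b'')%N -> D I J <= G ^+ a'' * B ^+ b''.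
Proof.
move=> [D0 _ _ _ _ _ Dt] sL h h' aa bb.
apply: le_trans (Dt I L J sL) _.
apply: le_trans (chain_power_le aa bb).
rewrite [leRHS](_ : _ = G * ((G ^+ a * B ^+ b) * (G ^+ a' * B ^+ b'))).
  by rewrite ler_wpM2l ?(le_trans ler01)// ler_pM.
by rewrite exprS !exprD; ring.
Qed.

(* Descend from the sibling of I towards J through the smaller child of each
   interval on the way: as soon as it contains J, the nested bound ends the
   chain. *)
Lemma chain_one_sided {D t I J} :
  chain_kernel n small G B D -> (t <= n.+1)%N ->
  ancestor t J = sibling I -> D I J <= G ^+ t.+1 * B ^+ maxn 1 t.
Proof.
move=> kD; have [D0 Du Dd Ds Dn Dn' Dt] := kD.
elim: t I => [|t IH] I tn /= eJ.
  by rewrite eJ !expr1.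
have nephew L : parent L = sibling I -> D I L <= G ^+ 0 * B ^+ 1.
  by move=> /Dn; rewrite expr0 mul1r.
case: t IH tn eJ => [|t] IH tn eJ.
  by rewrite (le_trans (nephew _ eJ))// chain_power_le.
pose L' := ancestor t.+1 J.
have [sL|sL] := small_sibling L'.
  apply: (chain_trans (a := 0) (b := 1) (a' := 1) (b' := 1) kD sL) => //.
  - exact: nephew.
  - by rewrite !expr1; apply: Du; lia.
(* The induction restarts from [sibling L'], whose own sibling [L'] still contains [J], one level
   further down. *)
have h : D (sibling L') J <= G ^+ t.+2 * B ^+ maxn 1 t.+1.
  by apply: IH; rewrite ?siblingK//; lia.
apply: (chain_trans (a := 0) (b := 1) kD sL _ h); last 2 first.
- by lia.
- by lia.
- by apply: nephew; rewrite parent_sibling.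
Qed.

(** Common ancestors are stripped until one interval contains the other or the two branches start at
    siblings. In the latter case the chain passes through a small sibling, one half being nested and
    the other bounded by [chain_one_sided]. *)
Lemma chain_bound {D N s t I J} :
  chain_kernel n small G B D ->
  (0 < N)%N -> n = N.+2 -> (s + t <= n)%N -> ancestor s I = ancestor t J ->
  D I J <= G ^+ n * B ^+ N.
Proof.
move=> kD N0 eN; have [D0 Du Dd Ds Dn Dn' Dt] := kD.
have kT := chain_kernel_tr kD.
have GB : G ^+ 1 * B ^+ 1 <= G ^+ n * B ^+ N by rewrite chain_power_le// eN.
rewrite !expr1 in GB.
elim: s t I J => [|s IHs] t I J stn.
  by move=> /= ->; rewrite (le_trans (Du _ _ _)).
case: t stn => [|t] stn /=.
  by move=> <-; rewrite (le_trans (Dd s.+1 _ _))//; lia.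
move=> /siblings_parent[e|e]; first by apply: (IHs t) => //; lia.
have e' : ancestor s I = sibling (ancestor t J) by rewrite e siblingK.
have hI := @chain_one_sided _ t _ _ kD _ e.
have hJ := @chain_one_sided _ s _ _ kT _ e'.
(* If one branch has length zero, its end is itself the sibling and the one-sided bound suffices. *)
have [s0|s0] := posnP s.
  rewrite s0 /= in hI; apply: le_trans (hI _) (chain_power_le _ _) => //; lia.
have [t0|t0] := posnP t.
  rewrite t0 /= in hJ; apply: le_trans (hJ _) (chain_power_le _ _) => //; lia.
(* Now [s] and [t] are positive with [s + t <= N], so [1 + t] and [1 + s], the exponents of [B] in
   the two cases, are at most [N]. *)
have [sL|sL] := small_sibling (ancestor s I).
  apply: (chain_trans (a := 1) (b := 1) kD sL _ (hI _)); try lia.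
  by rewrite !expr1; apply: Dd; lia.
rewrite -e in sL.
apply: (chain_trans (a' := 1) (b' := 1) kD sL (hJ _)); try lia.
by rewrite !expr1; apply: Du; lia.
Qed.

End chains.

(** * The kernel of a weight over a balanced mass *)

Definition small_interval {R : realType} (M m : dyadic -> R) (c : R) I : Prop :=
  M I <= 2 * c * m I.

Section weighted_kernel.
Context {R : realType} (M m W S : dyadic -> R) (p c B : R).
Hypotheses (p1 : 1 <= p) (c1 : 1 <= c).
Hypothesis m_def : forall I, m I = M (childl I) * M (childr I) / M I.
Hypothesis M_gt0 : forall I, 0 < M I.
Hypothesis M_split : forall I, M I = M (childl I) + M (childr I).
Hypothesis m_balanced :
  forall I, c^-1 * m (parent I) <= m I <= c * m (parent I).
Hypothesis W_gt0 : forall I, 0 < W I.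
Hypothesis W_split : forall I, W I = W (childl I) + W (childr I).
Hypothesis S_ge0 : forall I, 0 <= S I.
Hypothesis S_parent : forall I, S I <= S (parent I).
Hypothesis WS_ge : forall I, M I `^ p <= W I * S I.

(** On the diagonal this is (m/M)^p times the diagonal term of the characteristic, so that term
    needs its own bound [B_diag]. *)
Definition weighted_kernel I J : R :=
  (m I * m J) `^ (p / 2) * (W I * S J) / (M I * M J) `^ p.
Local Notation D := weighted_kernel.

Let p0 : 0 < p. Proof. exact: lt_le_trans p1. Qed.
Let c0 : 0 < c. Proof. exact: lt_le_trans c1. Qed.

Lemma hmass_gt0 I : 0 < m I.
Proof. by rewrite m_def divr_gt0 ?mulr_gt0. Qed.

Lemma hmass_le I : m I <= M I.
Proof.
have [[l0 r0] I0] := (M_gt0 (childl I), M_gt0 (childr I), M_gt0 I).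
rewrite m_def ler_pdivrMr// {1}(M_split I) mulrDl.
rewrite -[leLHS]addr0 lerD ?mulr_ge0 ?(ltW r0) ?(ltW I0)// ler_pM2l//.
by rewrite [leRHS]M_split lerDr ltW.
Qed.

Lemma hmass_parent I : m (parent I) <= c * m I.
Proof. by have /andP[h _] := m_balanced I; rewrite -ler_pdivrMl. Qed.

Lemma hmass_ancestor d J : m (ancestor d J) <= c ^+ d * m J.
Proof.
elim: d => [|d IH]/=; first by rewrite expr0 mul1r.
rewrite (le_trans (hmass_parent _))// exprS -mulrA ler_pM2l//.
Qed.

Lemma W_parent I : W I <= W (parent I).
Proof.
by rewrite [leRHS]W_split; case: (childP I) => {1}->; rewrite ?lerDl ?lerDr ltW.
Qed.

Lemma le_ancestor (F : dyadic -> R) d J :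
  (forall I, F I <= F (parent I)) -> F J <= F (ancestor d J).
Proof. by move=> h; elim: d => [|d IH]//=; exact: le_trans (h _). Qed.

Lemma powR_half {x} : 0 < x -> x `^ p = x `^ (p / 2) * x `^ (p / 2).
Proof.
move=> x0; rewrite -powRD ?(gt_eqF x0) ?implybT//.
by congr (_ `^ _); field.
Qed.

Lemma WS_ratio_ge1 I : 1 <= W I * S I / M I `^ p.
Proof. by rewrite ler_pdivlMr ?powR_gt0// mul1r. Qed.

Lemma weighted_kernel_ge0 I J : 0 <= D I J.
Proof. by rewrite /D divr_ge0 ?mulr_ge0 ?powR_ge0// ltW. Qed.

(** Balance compares [m] of the ancestor with [m J], and both factors are then at most multiples of
    [M J], the mass that cancels in [weighted_kernel_nested]. *)
Lemma hmass_ancestor_powR d J :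
  (m (ancestor d J) * m J) `^ (p / 2) <= (c ^+ d) `^ (p / 2) * M J `^ p.
Proof.
rewrite (powR_half (M_gt0 J)) mulrA -!powRM ?mulr_ge0 ?exprn_ge0 ?(ltW c0)
  ?(ltW (M_gt0 _))//.
rewrite ge0_ler_powR ?nnegrE ?mulr_ge0 ?exprn_ge0 ?invr_ge0 ?(ltW c0)
  ?(ltW p0) ?(ltW (M_gt0 _)) ?(ltW (hmass_gt0 _))//.
rewrite ler_pM ?hmass_le ?(ltW (hmass_gt0 _))//.
by rewrite (le_trans (hmass_ancestor _ _))// ler_wpM2l ?hmass_le// exprn_ge0 ?ltW.
Qed.

(** With [I] the ancestor, [x] stands for [W I * S J] or [W J * S I], so one estimate serves both
    orders of a nested pair. *)
Lemma weighted_kernel_nested {d J x} :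
  x <= W (ancestor d J) * S (ancestor d J) ->
  (m (ancestor d J) * m J) `^ (p / 2) * x / (M (ancestor d J) * M J) `^ p <=
  (c ^+ d) `^ (p / 2) *
    (W (ancestor d J) * S (ancestor d J) / M (ancestor d J) `^ p).
Proof.
move: (hmass_ancestor_powR d J); set I := ancestor d J => h xI.
rewrite [(M I * M J) `^ p]powRM ?(ltW (M_gt0 _))// ler_pdivrMr ?mulr_gt0 ?powR_gt0//.
rewrite [leRHS](_ : _ = (c ^+ d) `^ (p / 2) * M J `^ p * (W I * S I)).
  apply: (@le_trans _ _ ((m I * m J) `^ (p / 2) * (W I * S I))).
    by rewrite ler_wpM2l// powR_ge0.
  by rewrite ler_wpM2r// mulr_ge0// ltW.
by field; rewrite gt_eqF// powR_gt0.
Qed.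

(** The powers of [m L] cancel on the right, leaving [D I J] times the ratio of [WS_ratio_ge1] at
    [L]. *)
Lemma weighted_kernel_through L I J :
  D I J <= (M L / m L) `^ p * (D I L * D L J).
Proof.
have [[mI mL] mJ] := (hmass_gt0 I, hmass_gt0 L, hmass_gt0 J).
have [[MI ML] MJ] := (M_gt0 I, M_gt0 L, M_gt0 J).
rewrite /D !powRM ?invr_ge0 ?(ltW mL) ?(ltW mI) ?(ltW mJ) ?(ltW ML)
  ?(ltW MI) ?(ltW MJ)//.
have -> : (m L)^-1 `^ p = ((m L) `^ (p / 2) * (m L) `^ (p / 2))^-1.
  by rewrite -powR_half// -powR_inv1 ?(ltW mL)// -powRrM mulN1r powRN.
have := powR_gt0 (p / 2) mI; have := powR_gt0 (p / 2) mL.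
have := powR_gt0 (p / 2) mJ.
have := powR_gt0 p MI; have := powR_gt0 p ML; have := powR_gt0 p MJ.
have := WS_ratio_ge1 L; move: (m I `^ _) (m L `^ _) (m J `^ _).
move: (M I `^ _) (M L `^ _) (M J `^ _) => x y z i l j h z0 y0 x0 j0 l0 i0.
rewrite [leRHS](_ : _ = i * j * (W I * S J) / (x * z) * (W L * S L / y)).
  rewrite ler_peMr// divr_ge0 ?mulr_ge0 ?(ltW i0) ?(ltW j0) ?(ltW x0) ?(ltW z0)//.
  exact: ltW.
by field; rewrite !gt_eqF.
Qed.

(** Meant for [J] the sibling of [I], a pair outside [pair_b]: the children of [I] are nephews of
    [J]. Since [W] is additive, passing to a child costs one balance factor in [m], and the mass in
    the denominator only decreases. *)
Lemma weighted_kernel_split I J :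
  D I J <= c `^ (p / 2) * (D (childl I) J + D (childr I) J).
Proof.
rewrite /D [in leLHS]W_split mulrDl mulrDr mulrDl mulrDr.
have key K : parent K = I -> M K <= M I ->
    (m I * m J) `^ (p / 2) * (W K * S J) / (M I * M J) `^ p <=
    c `^ (p / 2) * ((m K * m J) `^ (p / 2) * (W K * S J) / (M K * M J) `^ p).
  move=> KI MKI; rewrite !mulrA ler_pM ?invr_ge0 ?powR_ge0//.
  - by rewrite !mulr_ge0 ?powR_ge0// ltW.
  - rewrite -powRM ?mulr_ge0 ?(ltW c0) ?(ltW (hmass_gt0 _))//.
    rewrite !ler_wpM2r// ?(ltW (W_gt0 _))//.
    rewrite ge0_ler_powR ?nnegrE ?mulr_ge0 ?invr_ge0 ?(ltW c0) ?(ltW p0)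
      ?(ltW (hmass_gt0 _))//.
    rewrite mulrA ler_wpM2r ?(ltW (hmass_gt0 _))// -KI; exact: hmass_parent.
  - rewrite lef_pV2 ?posrE ?powR_gt0 ?mulr_gt0//.
    rewrite ge0_ler_powR ?nnegrE ?mulr_ge0 ?(ltW p0) ?(ltW (M_gt0 _))//.
    by rewrite ler_wpM2r// ltW.
have [l0 r0] := (M_gt0 (childl I), M_gt0 (childr I)).
by apply: lerD; apply: key; rewrite ?parent_childl ?parent_childr//
  [leRHS]M_split ?lerDl ?lerDr ltW.
Qed.

Hypothesis B_diag : forall I, W I * S I / M I `^ p <= B.
Hypothesis B_nephew : forall I J, parent J = sibling I -> D I J <= B.
Hypothesis B_uncle : forall I J, parent J = sibling I -> D J I <= B.

Local Notation small := (small_interval M m c).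

(** The sibling of smaller mass is small: [m] of the parent is half the harmonic mean of the two
    masses, hence at least half the smaller one, and balance carries this down to [m] of that
    sibling. *)
Lemma small_sibling I : small I \/ small (sibling I).
Proof.
have small_le K K' : parent K = parent K' -> m (parent K) = M K * M K' / M (parent K) ->
    M K <= M K' -> M (parent K) = M K + M K' -> small K.
  move=> KK' mE KleK' ME; rewrite /small_interval.
  have := hmass_parent K; rewrite mE ME.
  have [MK MK'] := (M_gt0 K, M_gt0 K').
  rewrite ler_pdivrMr; last exact: addr_gt0.
  have := hmass_gt0 K; move: c0; nra.
have K2 K : small (childl K) \/ small (childr K).
  have [h|/ltW h] := leP (M (childl K)) (M (childr K)).
    left; apply: small_le h _ => //; rewrite ?parent_childl ?parent_childr//.
  right; apply: small_le h _ => //; rewrite ?parent_childl ?parent_childr//.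
    by rewrite m_def [M (childl _) * _]mulrC.
  by rewrite addrC.
rewrite /sibling; case: ifP => [/eqP|] e.
  by rewrite {1}e; exact: K2.
have := K2 (parent I).
by case: (childP I) => e'; [rewrite -e' eqxx in e|rewrite -e' => /or_comm].
Qed.

(** A single threshold on [G] dominates every loss: c^(dp/2) for nested pairs, 2c^(p/2) for
    siblings, (2c)^p for passing through a small interval. *)
Lemma weighted_chain_kernel n G : 1 <= B ->
  2 * (2 * c ^+ n) `^ p <= G -> (0 < n)%N ->
  chain_kernel n small G B D.
Proof.
move=> B1 hG n0; have B0 : 0 <= B by exact: le_trans B1.
have pow2 x y : 0 <= x -> x <= y -> x `^ (p / 2) <= y `^ (p / 2).
  move=> x0 xy; apply: ge0_ler_powR; rewrite ?nnegrE ?(le_trans x0 xy)//.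
  by rewrite divr_ge0// ltW.
have cn1 : 1 <= c ^+ n by exact: exprn_ege1.
have hG2 : 2 * (c ^+ n) `^ (p / 2) <= G.
  apply: le_trans hG; rewrite ler_pM2l//.
  rewrite (@le_trans _ _ ((2 * c ^+ n) `^ (p / 2)))// ?pow2 ?ler_powR//.
  - exact: le_trans cn1.
  - by rewrite ler_peMl ?ler1n// (le_trans _ cn1).
  - by rewrite (le_trans cn1)// ler_peMl ?ler1n// (le_trans _ cn1).
  - by rewrite ler_pdivrMr// ler_peMr ?ler1n// ltW.
have hGd d : (d <= n)%N -> (c ^+ d) `^ (p / 2) <= G.
  move=> dn; apply: le_trans hG2; apply: (@le_trans _ _ ((c ^+ n) `^ (p / 2))).
    by apply: pow2; [exact: exprn_ge0 (ltW c0)|exact: ler_weXn2l].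
  by rewrite ler_peMl ?powR_ge0// ler1n.
have hGs : 2 * c `^ (p / 2) <= G.
  by apply: le_trans hG2; rewrite ler_pM2l// pow2 ?(ltW c0)// ler_eXnr.
have hGp : (2 * c) `^ p <= G.
  apply: le_trans hG.
  rewrite (@le_trans _ _ ((2 * c ^+ n) `^ p))// ?ler_peMl ?powR_ge0 ?ler1n//.
  rewrite ge0_ler_powR ?nnegrE ?(ltW p0) ?mulr_ge0 ?exprn_ge0 ?(ltW c0)//.
  by rewrite ler_pM2l// ler_eXnr.
split => //.
- exact: weighted_kernel_ge0.
- move=> d J dn; rewrite /D.
  apply: le_trans (weighted_kernel_nested _) _.
    by rewrite ler_pM2l// le_ancestor.
  by rewrite ler_pM ?powR_ge0 ?hGd// divr_ge0 ?powR_ge0 ?mulr_ge0// ltW.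
- move=> d J dn; rewrite /D [m J * _]mulrC [M J * _]mulrC.
  apply: le_trans (weighted_kernel_nested _) _.
    by rewrite ler_wpM2r// le_ancestor//; exact: W_parent.
  by rewrite ler_pM ?powR_ge0 ?hGd// divr_ge0 ?powR_ge0 ?mulr_ge0// ltW.
- move=> I; apply: le_trans (weighted_kernel_split _ _) _.
  apply: (@le_trans _ _ (c `^ (p / 2) * (B + B))).
    by rewrite ler_wpM2l ?powR_ge0// lerD// B_uncle// siblingK
      ?parent_childl ?parent_childr.
  rewrite [leLHS](_ : _ = 2 * c `^ (p / 2) * B); last by ring.
  exact: ler_wpM2r.
- move=> I L J sL; apply: le_trans (weighted_kernel_through L I J) _.
  apply: ler_wpM2r; first by rewrite mulr_ge0// weighted_kernel_ge0.
  apply: le_trans hGp.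
  rewrite ge0_ler_powR ?nnegrE ?(ltW p0) ?mulr_ge0 ?invr_ge0 ?(ltW c0)
    ?(ltW (hmass_gt0 _)) ?(ltW (M_gt0 _))//.
  by rewrite ler_pdivrMr ?hmass_gt0.
Qed.

End weighted_kernel.

Arguments small_sibling {R M m c}.
Arguments weighted_chain_kernel {R M m W S p c B} _ _ _ _ _ _ _ _ _ _ _ _ _ _ {n G}.

(** * Hölder inequalities for an almost everywhere positive function *)

Section ae_positive.
Context d {T : measurableType d} {R : realType}.
Variable mu : {measure set T -> \bar R}.
Variables (w : T -> R) (A : set T).
Hypotheses (mA : measurable A) (mw : measurable_fun [set: T] w).
Hypothesis w_gt0 : {ae mu, forall x, 0 < w x}.
Local Open Scope ereal_scope.

Let mwA : measurable_fun A w. Proof. exact: measurable_funTS. Qed.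

(** Positivity holds only almost everywhere; the absolute value gives an integrand that is
    nonnegative at every point. *)
Lemma ae_gt0_integral_abs : \int[mu]_(x in A) (w x)%:E = \int[mu]_(x in A) `|w x|%:E.
Proof.
apply: ae_eq_integral => //.
- exact/measurable_EFinP.
- by apply/measurable_EFinP; exact: measurableT_comp.
- by apply: filterS w_gt0 => x wx _; rewrite gtr0_norm.
Qed.

Lemma ae_gt0_integral_gt0 : 0 < mu A -> 0 < \int[mu]_(x in A) `|w x|%:E.
Proof.
move=> A0; rewrite lt_def integral_ge0 ?andbT => [|x _]; last by rewrite lee_fin.
apply/eqP => /(ae_eq_integral_abs mu mA (f := EFin \o w)) h.
have /h w0 : measurable_fun A (EFin \o w) by exact/measurable_EFinP.
suff : mu A = 0 by move=> e; rewrite e ltxx in A0.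
apply: measure_negligible => //.
have : {ae mu, forall x, ~ A x}.
  apply: filterS2 w_gt0 w0 => x wx h' Ax.
  by have := h' Ax; case=> e; rewrite e ltxx in wx.
by apply: negligibleS => x Ax /=; apply.
Qed.

(** Hölder's inequality for [u] = |w|^(1/p) and [v] = w^(-1/p), whose product is 1 almost everywhere
    on [A], raised to the power [p]. *)
Lemma holder_ae_gt0 p : (1 < p)%R ->
  mu A `^ p <= \int[mu]_(x in A) `|w x|%:E *
    (\int[mu]_(x in A) (w x `^ (1 - p / (p - 1)))%:E) `^ (p - 1).
Proof.
move=> p1; have p0 : (0 < p)%R by exact: lt_trans p1.
have pB0 : (0 < p - 1)%R by rewrite subr_gt0.
have pn0 : p != 0%R by rewrite gt_eqF.
have pBn0 : (p - 1 != 0)%R by rewrite gt_eqF.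
pose q := (p / (p - 1))%R; have q0 : (0 < q)%R by rewrite divr_gt0.
pose u x := (`|w x| `^ p^-1)%R.
(* The exponent equals -1/p; in this form the [q]-th power is visibly w^(1-q). *)
pose v x := (w x `^ ((1 - q) / q))%R.
have mu_meas : measurable_fun A u.
  apply: (measurableT_comp (measurable_powR _)).
  exact: measurableT_comp.
have mv : measurable_fun A v by exact: (measurableT_comp (measurable_powR _)).
have mu' : measurable_fun [set: T] (u \_ A).
  by exact: (measurable_restrictT u mA).1 mu_meas.
have mv' : measurable_fun [set: T] (v \_ A).
  by exact: (measurable_restrictT v mA).1 mv.
have pq : (p^-1 + q^-1 = 1)%R by rewrite /q invf_div; field.
have := hoelder mu mu' mv' p0 q0 pq.
have -> : 'N[mu]_1[EFin \o (u \_ A \* v \_ A)%R] = mu A.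
  rewrite Lnorm1.
  transitivity (\int[mu]_(x in A) (cst 1 x)); last first.
    by rewrite integral_cst// mul1e.
  rewrite [RHS]integral_mkcond; apply: ae_eq_integral => //.
  - apply: measurableT_comp => //; apply/measurable_EFinP.
    exact: measurable_funM.
  - by apply: (measurable_restrictT (cst 1) mA).1; exact: measurable_cst.
  apply: filterS w_gt0 => x wx _ /=; rewrite /patch.
  case: ifPn => _; last by rewrite mulr0 normr0.
  rewrite /u /v (gtr0_norm wx) -powRD; last by rewrite (gt_eqF wx) implybT.
  rewrite (_ : _ + _ = 0)%R ?powRr0 ?normr1//.
  by rewrite /q ?invf_div; field; rewrite ?pn0 ?pBn0.
have -> : 'N[mu]_p%:E[EFin \o u \_ A] = (\int[mu]_(x in A) `|w x|%:E) `^ p^-1.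
  rewrite Lnorm.unlock; congr (_ `^ _).
  rewrite [RHS]integral_mkcond; apply: eq_integral => x _ /=; rewrite /patch.
  case: ifPn => _; last by rewrite normr0 powR0.
  by rewrite ger0_norm ?powR_ge0// -powRrM mulVf// powRr1.
have -> : 'N[mu]_q%:E[EFin \o v \_ A] =
    (\int[mu]_(x in A) (w x `^ (1 - q))%:E) `^ q^-1.
  rewrite Lnorm.unlock; congr (_ `^ _).
  rewrite [RHS]integral_mkcond; apply: eq_integral => x _ /=; rewrite /patch.
  case: ifPn => _; last by rewrite normr0 powR0// gt_eqF.
  by rewrite ger0_norm ?powR_ge0// -powRrM divfK// gt_eqF.
set X := \int[mu]_(_ in _) _; set Y := \int[mu]_(_ in _) _ => h.
have X0 : 0 <= X by apply: integral_ge0 => x _; rewrite lee_fin.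
have Y0 : 0 <= Y by apply: integral_ge0 => x _; rewrite lee_fin powR_ge0.
have := @gt0_ler_poweR _ p (ltW p0) _ _ _ _ h.
rewrite !in_itv/= !leey !andbT measure_ge0 mule_ge0 ?poweR_ge0// => /(_ isT isT).
rewrite poweRM ?poweR_ge0// -!poweRrM mulVf// poweRe1//.
by rewrite (_ : q^-1 * p = p - 1)%R// /q; field; rewrite ?pn0 ?pBn0.
Qed.

(** The endpoint case: 1 is at most [w] times the supremum of 1/w almost everywhere on [A], and this
    is integrated over [A]. *)
Lemma holder_Linfty : 0 < mu A ->
  mu A <= \int[mu]_(x in A) `|w x|%:E *
    'N[mu]_+oo[(EFin \o (fun x => (w x)^-1%R)) \_ A].
Proof.
move=> A0; have W0 := ae_gt0_integral_gt0 A0; move: W0.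
set W := \int[mu]_(_ in _) _ => W0.
(* The norm with exponent +oo is the essential supremum only when the whole space has positive
   measure, and 0 otherwise. *)
have T0 : 0 < mu [set: T].
  by apply: lt_le_trans A0 _; apply: le_measure; rewrite ?inE.
rewrite Lnorm.unlock T0.
set f := _ \_ A; set s := ess_sup _ _.
have s0 : 0 <= s by apply: ess_sup_gee => //; apply: nearW => x /=.
(* An infinite supremum gives +oo on the right because [W] is positive. *)
have [sy|sfin] := eqVneq s +oo; first by rewrite sy gt0_muley// leey.
have [r rE] : exists r, s = r%:E.
  by exists (fine s); rewrite fineK// ge0_fin_numE// lt_neqAle sfin leey.
have r0 : (0 <= r)%R by rewrite -lee_fin -rE.
rewrite rE muleC -ge0_integralZl_EFin//; last first.
  by apply/measurable_EFinP; exact: measurableT_comp.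
rewrite -[leLHS]mul1e -integral_cst//.
apply: ae_ge0_le_integral => //.
- by move=> x _; rewrite -EFinM lee_fin mulr_ge0.
- apply: emeasurable_funM => //.
  by apply/measurable_EFinP; exact: measurableT_comp.
have := ess_sup_ge mu (abse \o f); rewrite -/s rE => hs.
apply: filterS2 w_gt0 hs => x wx /= h Ax.
move: h; rewrite /f /patch mem_set//= lee_fin normfV (gtr0_norm wx) => h.
by rewrite -EFinM lee_fin -ler_pdivrMr// mul1r.
Qed.

Lemma Linfty_restrict_le (f : T -> R) (B C : set T) : B `<=` C ->
  'N[mu]_+oo[(EFin \o f) \_ B] <= 'N[mu]_+oo[(EFin \o f) \_ C].
Proof.
move=> BC; rewrite Lnorm.unlock; case: ifPn => // T0.
apply: le_ess_sup; apply: nearW => x /=; rewrite /patch.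
case: ifPn => [xB|_]; last by rewrite abse0 abse_ge0.
by rewrite ifT// inE; apply: BC; exact: set_mem.
Qed.

End ae_positive.

(** * The two families of pairs in terms of parents and ancestors *)

Lemma sibling_level I : (sibling I).1 = I.1.
Proof. by rewrite /sibling; case: ifP => _ /=; rewrite subrK. Qed.

Lemma nephew_neq I J : parent J = sibling I -> J <> I.
Proof.
by move=> /(congr1 fst) e JI; move: e; rewrite sibling_level JI /=; lia.
Qed.

Lemma childlrP I J : parent J = I -> J = childl I \/ J = childr I.
Proof. by move=> <-; exact: childP. Qed.

Lemma pair_N_ancestor (R : realType) N I J : @pair_N R N I J ->
  exists s t : nat, (s + t <= N + 2)%N /\ ancestor s I = ancestor t J.
Proof.
rewrite /pair_N /dyadic_dist => h.
(* The strict bound [N + 3] produces a witness below it, and integrality brings [s + t] back to at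
   most [N + 2]. *)
have /ereal_inf_lt[_ [s [t [e ->]]]] : (ereal_inf [set d | exists s t : nat,
    ancestor s I = ancestor t J /\ d = (s + t)%:R%:E] < (N + 3)%:R%:E :> \bar R)%E.
  by apply: le_lt_trans h _; rewrite lte_fin ltr_nat ltn_add2l.
by rewrite lte_fin ltr_nat => st; exists s, t; split => //; lia.
Qed.

Lemma ancestor_pair_N (R : realType) N s t I J : (s + t <= N + 2)%N ->
  ancestor s I = ancestor t J -> @pair_N R N I J.
Proof.
move=> st e; apply: (@le_trans _ _ (s + t)%:R%:E); last first.
  by rewrite lee_fin ler_nat.
by apply: ereal_inf_lbound; exists s, t.
Qed.

Lemma pair_bP I J : pair_b I J <->
  [\/ J = I, parent J = sibling I | parent I = sibling J].
Proof.
split.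
  case=> [[->|->|->]|[->|->]]; rewrite ?parent_childl ?parent_childr.
  - exact: Or31.
  - exact: Or32.
  - exact: Or32.
  - exact: Or33.
  - exact: Or33.
case=> [->|/childlrP[->|->]|/childlrP[->|->]].
- by left; exact: Or31.
- by left; exact: Or32.
- by left; exact: Or33.
- by right; left.
- by right; right.
Qed.

(** An interval and a child of its sibling meet after one and two steps, and 3 is at most [N + 2] as
    [N] is positive. *)
Lemma pair_b_N (R : realType) N I J : (0 < N)%N -> pair_b I J -> @pair_N R N I J.
Proof.
move=> N0 /pair_bP[->|e|e].
- by apply: (@ancestor_pair_N _ _ 0 0).
- apply: (@ancestor_pair_N _ _ 1 2); first by lia.
  by rewrite /= e parent_sibling.
- apply: (@ancestor_pair_N _ _ 2 1); first by lia.
  by rewrite /= e parent_sibling.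
Qed.

Lemma dyad_parent (R : realType) I : dyad R I `<=` dyad R (parent I).
Proof.
have [e _] := @dyad_children R (parent I).
by rewrite e; case: (childP I) => {1}->; [exact: subsetUl|exact: subsetUr].
Qed.

(** * Terms of the characteristics as values of the kernel *)

Section dyadic_weight.
Context {R : realType} (mu : {measure set (measurableTypeR R) -> \bar R}).
Context (w : R -> R) (p : R).
Hypotheses (mu_fin : dyadic_pos_fin mu) (ww : weight mu w) (p1 : 1 <= p).

Let T := measurableTypeR R.

Lemma measurable_dyad I : measurable (dyad R I : set T).
Proof. exact: measurable_itv. Qed.
#[local] Hint Resolve measurable_dyad : core.

Lemma massE I : mu (dyad R I) = (mass mu I)%:E.
Proof.
have /andP[a b] := mu_fin I.
by rewrite /mass fineK// ge0_fin_numE// ltW.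
Qed.

Lemma mass_gt0 I : 0 < mass mu I.
Proof. by have /andP[a _] := mu_fin I; rewrite -lte_fin -massE. Qed.

Lemma mass_split I : mass mu I = mass mu (childl I) + mass mu (childr I).
Proof.
have [e e0] := @dyad_children R I.
apply: EFin_inj; rewrite EFinD -!massE e measureU//.
Qed.

Definition wint I : R := fine (\int[mu]_(x in dyad R I) `|w x|%:E)%E.

(* Normalized so that the last factor of Ap_term is, for every p >= 1, equal to
   dual_int J divided by mass J `^ (p - 1). *)
Definition dual_int J : \bar R :=
  (if p == 1%R then Linfty mu (fun x => (w x)^-1%R) J
   else (\int[mu]_(x in dyad R J) (w x `^ (1 - conjugate p))%:E) `^ (p - 1)%R)%E.

Let mw : measurable_fun [set: T] (w : T -> R). Proof. by case: ww. Qed.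
Let mwI I : measurable_fun (dyad R I : set T) (w : T -> R).
Proof. exact: measurable_funTS. Qed.
Let w_gt0 : {ae mu, forall x, 0 < w x}. Proof. by case: ww. Qed.
Let mw_abs I : measurable_fun (dyad R I : set T) (fun x : T => `|w x|%:E).
Proof. by apply/measurable_EFinP; exact: measurableT_comp. Qed.

(** Finiteness comes from local integrability on the compact closure of the dyadic interval. *)
Lemma wintE I : (\int[mu]_(x in dyad R I) `|w x|%:E)%E = (wint I)%:E.
Proof.
rewrite /wint fineK// ge0_fin_numE; last first.
  by apply: integral_ge0 => x _; rewrite lee_fin.
case: ww => _ _ wloc.
pose K : set R := `[2 ^ (- I.1) * I.2%:~R, 2 ^ (- I.1) * (I.2 + 1)%:~R]%classic.
apply: le_lt_trans (wloc K (@segment_compact _ _ _)).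
apply: ge0_subset_integral => //.
- exact: measurable_itv.
- by apply/measurable_EFinP; apply: measurableT_comp => //; exact: measurable_funTS.
- by apply: subset_itvl; rewrite bnd_simp.
Qed.

Lemma average_weight I : average mu w I = (wint I / mass mu I)%:E.
Proof. by rewrite /average ae_gt0_integral_abs// wintE -EFinM mulrC. Qed.

Lemma wint_gt0 I : 0 < wint I.
Proof.
rewrite -lte_fin -wintE ae_gt0_integral_gt0//.
by have /andP[] := mu_fin I.
Qed.

Lemma wint_split I : wint I = wint (childl I) + wint (childr I).
Proof.
have [e e0] := @dyad_children R I.
apply: EFin_inj; rewrite EFinD -!wintE e ge0_integral_setU//.
- by rewrite -e.
- by apply/disj_set2P.
Qed.

Let mdual I : measurable_fun (dyad R I : set T)
  (fun x : T => (w x `^ (1 - conjugate p))%:E).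
Proof.
apply/measurable_EFinP.
exact: (measurableT_comp (measurable_powR _) (mwI I)).
Qed.

Lemma dual_int_ge0 I : (0 <= dual_int I)%E.
Proof. by rewrite /dual_int; case: ifP => _; rewrite ?Lnorm_ge0 ?poweR_ge0. Qed.

Lemma dual_int_parent I : (dual_int I <= dual_int (parent I))%E.
Proof.
rewrite /dual_int; case: ifP => _.
  by apply: Linfty_restrict_le; exact: dyad_parent.
have i0 J : (0 <= \int[mu]_(x in dyad R J) (w x `^ (1 - conjugate p))%:E)%E.
  by apply: integral_ge0 => x _; rewrite lee_fin powR_ge0.
apply: gt0_ler_poweR; rewrite ?subr_ge0 ?in_itv/= ?i0 ?leey//.
apply: ge0_subset_integral => //; last exact: dyad_parent.
by move=> x _; rewrite lee_fin powR_ge0.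
Qed.

Lemma conjugateE : p != 1 -> conjugate p = p / (p - 1).
Proof.
move=> pn1; have pB0 : p - 1 != 0 by rewrite subr_eq0.
have p0 : p != 0 by rewrite gt_eqF// (lt_le_trans _ p1).
by rewrite /conjugate /hoelder_conjugate/= eqe (negbTE p0) inver (negbTE pB0).
Qed.

Lemma wint_dual_int I : ((mass mu I `^ p)%:E <= (wint I)%:E * dual_int I)%E.
Proof.
have muI : (0 < mu (dyad R I))%E by have /andP[] := mu_fin I.
rewrite /dual_int; case: ifPn => [/eqP ->|pn1].
  by rewrite powRr1 ?(ltW (mass_gt0 _))// -massE -wintE holder_Linfty.
rewrite -poweR_EFin -massE -wintE conjugateE// holder_ae_gt0//.
by rewrite lt_neqAle eq_sym pn1.
Qed.

Lemma Ap_termE I J : Ap_term mu p w I J =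
  ((cb mu p I J * (wint I / mass mu I) / mass mu J `^ (p - 1))%:E *
    dual_int J)%E.
Proof.
rewrite /Ap_term average_weight -EFinM [in RHS]EFinM -muleA; congr (_ * _)%E.
rewrite /dual_int; case: ifPn => [/eqP ->|pn1].
  by rewrite subrr powRr0 invr1 mul1e.
rewrite /average poweRM.
- by rewrite poweR_EFin -powR_inv1 ?(ltW (mass_gt0 _))// -powRrM mulN1r powRN.
- by rewrite lee_fin invr_ge0 (ltW (mass_gt0 _)).
- by apply: integral_ge0 => x _; rewrite lee_fin powR_ge0.
Qed.

Lemma Ap_b_ge0 : (0 <= Ap_b mu p w)%E.
Proof.
apply: (@le_trans _ _ (Ap_term mu p w (0, 0) (0, 0))).
  rewrite Ap_termE /cb eqxx mul1r mule_ge0 ?dual_int_ge0// lee_fin.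
  by rewrite !divr_ge0 ?powR_ge0 ?(ltW (wint_gt0 _)) ?(ltW (mass_gt0 _)).
apply: ereal_sup_ubound; exists (0, 0), (0, 0); split=> //.
by apply/pair_bP/Or31.
Qed.

(** All other factors of the diagonal term at [I] are positive, so an infinite [dual_int I] would
    make that term infinite. *)
Lemma dual_int_fin_num I : (Ap_b mu p w < +oo)%E -> dual_int I \is a fin_num.
Proof.
move=> fin; rewrite ge0_fin_numE ?dual_int_ge0//.
have : (Ap_term mu p w I I < +oo)%E.
  apply: le_lt_trans fin; apply: ereal_sup_ubound; exists I, I; split => //.
  by apply/pair_bP/Or31.
rewrite Ap_termE /cb eqxx mul1r; apply: contraTT; rewrite -!leNgt !leye_eq.
move=> /eqP ->; rewrite gt0_muley// lte_fin !divr_gt0 ?powR_gt0 ?mass_gt0//.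
exact: wint_gt0.
Qed.

(** Each mass occurs once with exponent 1 and once with exponent [p - 1], one from [cb] and one from
    an average; together they give the power [p]. *)
Lemma Ap_term_weighted_kernel I J : dual_int J \is a fin_num -> I <> J ->
  Ap_term mu p w I J =
  (weighted_kernel (mass mu) (mm mu) wint (fine \o dual_int) p I J)%:E.
Proof.
move=> fJ /eqP IJ; rewrite Ap_termE -(fineK fJ) -EFinM; congr EFin.
rewrite /cb (negbTE IJ) /weighted_kernel /=.
have m0 K : 0 < mm mu K by rewrite /mm divr_gt0 ?mulr_gt0 ?mass_gt0.
have [MI MJ] := (mass_gt0 I, mass_gt0 J).
rewrite (powRM _ (ltW (m0 I)) (ltW (m0 J))) (powRM _ (ltW MI) (ltW MJ)).
rewrite -(mulr_powRB1 (ltW MI) (lt_le_trans ltr01 p1)).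
rewrite -(mulr_powRB1 (ltW MJ) (lt_le_trans ltr01 p1)).
have := powR_gt0 (p - 1) MI; have := powR_gt0 (p - 1) MJ => j0 i0.
by field; rewrite !gt_eqF.
Qed.

Lemma Ap_term_diag I : dual_int I \is a fin_num ->
  Ap_term mu p w I I = (wint I * fine (dual_int I) / mass mu I `^ p)%:E.
Proof.
move=> fI; rewrite Ap_termE -(fineK fI) -EFinM /cb eqxx mul1r; congr EFin.
have MI := mass_gt0 I.
rewrite -(mulr_powRB1 (ltW MI) (lt_le_trans ltr01 p1)).
by field; rewrite !gt_eqF// powR_gt0.
Qed.

Lemma Ap_N_le (c : R) N : 1 <= c ->
  (forall I, c^-1 * mm mu (parent I) <= mm mu I <= c * mm mu (parent I)) ->
  (0 < N)%N ->
  (Ap_N mu N p w <=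
    ((2 * (2 * c ^+ N.+2) `^ p) ^+ N.+2)%:E * Ap_b mu p w ^+ (2 ^ N.-1)%N)%E.
Proof.
move=> c1 bal N0.
set G := 2 * _; have [c0 p0] : 0 < c /\ 0 < p.
  by split; [exact: lt_le_trans c1|exact: lt_le_trans p1].
have G1 : 1 <= G.
  rewrite /G (@le_trans _ _ 2) ?ler1n// ler_peMr//.
  have h : 1 <= 2 * c ^+ N.+2 by rewrite mulr_ege1 ?ler1n ?exprn_ege1.
  apply: (@le_trans _ _ (1 `^ p)); first by rewrite powR1.
  by rewrite ge0_ler_powR ?nnegrE ?(ltW p0) ?(le_trans ler01 h).
(* If [Ap_b] is infinite, so is the right-hand side, its exponent and its constant being
   positive. *)
have [|fin] := leP +oo%E (Ap_b mu p w).
  rewrite leye_eq => /eqP ->.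
  have y k : (0 < k)%N -> (+oo ^+ k = +oo :> \bar R)%E.
    by elim: k => // -[|k] IH _; rewrite ?expe1// expeS IH.
  rewrite y ?expn_gt0//.
  rewrite gt0_muley ?leey// lte_fin exprn_gt0//; exact: lt_le_trans G1.
have fd I := dual_int_fin_num I fin.
pose B := fine (Ap_b mu p w).
have term_le I J : pair_b I J -> (Ap_term mu p w I J <= Ap_b mu p w)%E.
  by move=> IJ; apply: ereal_sup_ubound; exists I, J.
have diag_le I : (Ap_term mu p w I I <= Ap_b mu p w)%E.
  by apply/term_le/pair_bP/Or31.
have diag1 I : 1 <= wint I * fine (dual_int I) / mass mu I `^ p.
  rewrite ler_pdivlMr ?powR_gt0 ?mass_gt0// mul1r -lee_fin EFinM (fineK (fd I)).
  exact: wint_dual_int.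
have BE : Ap_b mu p w = B%:E.
  rewrite /B fineK// ge0_fin_numE//; apply: le_trans (diag_le (0, 0)).
  by rewrite Ap_term_diag// lee_fin (le_trans ler01).
have diagB I : wint I * fine (dual_int I) / mass mu I `^ p <= B.
  by rewrite -lee_fin -BE -Ap_term_diag.
(* By Hölder every diagonal term is at least 1, so higher powers of [B] dominate lower ones. *)
have B1 : 1 <= B by exact: le_trans (diag1 (0, 0)) (diagB _).
rewrite BE -EFin_expe -EFinM.
have m1 I : mm mu I = mass mu (childl I) * mass mu (childr I) / mass mu I by [].
have S0 I : 0 <= (fine \o dual_int) I by rewrite fine_ge0 ?dual_int_ge0.
have Sp I : (fine \o dual_int) I <= (fine \o dual_int) (parent I).
  by rewrite fine_le ?dual_int_parent.
have WS I : mass mu I `^ p <= wint I * (fine \o dual_int) I.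
  by have := diag1 I; rewrite ler_pdivlMr ?powR_gt0 ?mass_gt0// mul1r.
have neph I J : parent J = sibling I ->
    weighted_kernel (mass mu) (mm mu) wint (fine \o dual_int) p I J <= B.
  move=> e; rewrite -lee_fin -BE -Ap_term_weighted_kernel//.
    by apply/term_le/pair_bP/Or32.
  by apply/nesym/nephew_neq.
have uncle I J : parent J = sibling I ->
    weighted_kernel (mass mu) (mm mu) wint (fine \o dual_int) p J I <= B.
  move=> e; rewrite -lee_fin -BE -Ap_term_weighted_kernel//.
    by apply/term_le/pair_bP/Or33.
  exact: nephew_neq.
have kern := weighted_chain_kernel p1 c1 m1 mass_gt0 mass_split bal wint_gt0
  wint_split S0 Sp WS diagB neph uncle B1 (lexx _ : G <= G) (ltn0Sn N.+1).
have small := small_sibling c1 m1 mass_gt0 mass_split bal.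
apply: ge_ereal_sup => _ [I [J [/pair_N_ancestor[s [t [st e]]] ->]]].
(* From [N.-1 < 2 ^ N.-1] follows that [N] is at most [2 ^ N.-1]. *)
have NB : B ^+ N <= B ^+ (2 ^ N.-1).
  by apply: ler_weXn2l => //; have := ltn_expl N.-1 (isT : 1 < 2)%N; lia.
have [<-|/eqP IJ] := eqVneq I J.
  apply: le_trans (diag_le I) _; rewrite BE lee_fin -[leLHS]mul1r.
  rewrite ler_pM// ?exprn_ege1// ?(le_trans ler01)//.
  by rewrite ler_eXnr// expn_gt0.
rewrite Ap_term_weighted_kernel// lee_fin.
apply: (@le_trans _ _ (G ^+ N.+2 * B ^+ N)).
  by apply: (chain_bound _ _ _ _ G1 B1 small kern N0 _ _ e) => //; lia.
by rewrite ler_wpM2l// exprn_ge0// (le_trans _ G1).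
Qed.

End dyadic_weight.

(** * Comparison of the two characteristics *)

Theorem lemma3p3 (R : realType)
    (mu : {measure set (measurableTypeR R) -> \bar R})
    (mu_fin : dyadic_pos_fin mu) (mu_bal : balanced mu)
    (N : nat) (N1 : (1 <= N)%N) (p : R) (p1 : 1 <= p) :
  exists C1 C2 : R, [/\ 0 < C1, 0 < C2 &
    forall w : R -> R, weight mu w ->
      [/\ (Ap_b mu p w <= C1%:E * Ap_N mu N p w)%E,
          (Ap_N mu N p w <= C2%:E * Ap_b mu p w ^+ (2 ^ N.-1)%N)%E &
          (Ap_N mu N p w < +oo)%E <-> (Ap_b mu p w < +oo)%E]].
Proof.
case: mu_bal => _ [c [c1 bal]].
(* The first constant is 1 because [pair_b] is contained in [pair_N]; the second is that of
   [Ap_N_le]. *)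
exists 1, ((2 * (2 * c ^+ N.+2) `^ p) ^+ N.+2).
have c0 : 0 < c by exact: lt_le_trans c1.
split=> [//||w ww].
  by rewrite exprn_gt0// mulr_gt0// powR_gt0// mulr_gt0// exprn_gt0.
have bN : (Ap_b mu p w <= Ap_N mu N p w)%E.
  apply: ereal_sup_le => _ [I [J [IJ ->]]]; exists I, J; split=> //.
  exact: pair_b_N.
have Nb := Ap_N_le mu w p mu_fin ww p1 c N c1 bal N1.
split=> //; first by rewrite mul1e.
split=> [|fin]; first exact: le_lt_trans.
apply: le_lt_trans Nb _.
have /fineK <- : Ap_b mu p w \is a fin_num.
  by rewrite ge0_fin_numE// Ap_b_ge0.
by rewrite -EFin_expe -EFinM ltry.
Qed.
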